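(* Let $\Omega\subset\mathbb R^d$ be convex and compact with nonempty interior. Then the logarithmic entropy $\mathcal E:\mathcal M(\Omega)\to\mathbb R\cup\{\infty\}$, $$\mathcal E(\mu)=\int_\Omega F_{\mathrm B}(u(x))\,\mathrm dx\ \text{ for }\mu=u\,\mathrm dx,\qquad F_{\mathrm B}(z)=z\log z-z+1\ (F_{\mathrm B}(0)=1),$$ (and $\mathcal E(\mu)=\infty$ if $\mu$ is not absolutely continuous with respect to Lebesgue measure) is not geodesically $\Lambda$-convex with respect to $\mathsf{HK}$ for any $\Lambda\in\mathbb R$.
   Context: $\mathcal M(\Omega)$ is the set of finite nonnegative Borel measures on $\Omega$. The cone over $\Omega$ is $\mathfrak C_\Omega:=(\Omega\times[0,\infty[)/(\Omega\times\{0\})$, with points $[x,r]$, and metric $\mathsf d_{\mathfrak C}([x_0,r_0],[x_1,r_1])^2=r_0^2+r_1^2-2r_0r_1\cos_\pi(|x_0-x_1|)$, $\cos_\pi(L)=\cos(\min\{L,\pi\})$. $\mathcal M_2(\mathfrak C_\Omega)$ is the set of finite nonnegative Borel measures with $\int r^2\mathrm d\lambda<\infty$. $\mathsf W_{\mathfrak C}(\lambda_0,\lambda_1)^2=\inf\iint\mathsf d_{\mathfrak C}^2\,\mathrm d\gamma$ over nonnegative measures $\gamma$ on $\mathfrak C_\Omega\times\mathfrak C_\Omega$ with marginals $\lambda_0,\lambda_1$ ($=\infty$ if the masses differ). The projection $\mathfrak P:\mathcal M_2(\mathfrak C_\Omega)\to\mathcal M(\Omega)$ is given by $\int_\Omega\phi\,\mathrm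 d\mathfrak P\lambda=\int r^2\phi(x)\,\mathrm d\lambda([x,r])$, $\phi\in\mathrm C^0(\Omega)$. The Hellinger–Kantorovich distance is $\mathsf{HK}(\mu_0,\mu_1)=\min\{\mathsf W_{\mathfrak C}(\lambda_0,\lambda_1)\mid\mathfrak P\lambda_j=\mu_j\}$. A geodesic curve is a curve with $\mathsf{HK}(\mu(s),\mu(t))=|s-t|\,\mathsf{HK}(\mu(0),\mu(1))$ for all $s,t\in[0,1]$. A functional $\mathcal F:\mathcal M(\Omega)\to\mathbb R\cup\{\infty\}$ is geodesically $\Lambda$-convex if for all geodesic curves $\mu:[0,1]\to\mathcal M(\Omega)$ and all $s\in[0,1]$, $\mathcal F(\mu(s))\le(1-s)\mathcal F(\mu(0))+s\mathcal F(\mu(1))-\Lambda\frac{s(1-s)}2\mathsf{HK}(\mu(0),\mu(1))^2$. *)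

(* Defs.v *)
From HB Require Import structures.
From mathcomp Require Import all_boot all_order all_algebra.
From mathcomp Require Import lra.
From mathcomp Require Import all_classical all_reals all_analysis.
From mathcomp Require Import measurable_realfun.

Set Implicit Arguments.
Unset Strict Implicit.
Unset Printing Implicit Defensive.
Import Order.TTheory GRing.Theory Num.Theory.
Import numFieldNormedType.Exports.

Local Open Scope classical_set_scope.
Local Open Scope ring_scope.

Notation borel T := (g_sigma_algebraType (@open T)).

Lemma measurable_g_sigma d (T : measurableType d) (U : pointedType)
    (G : set (set U)) (f : T -> g_sigma_algebraType G) :
  (forall A, G A -> measurable (f @^-1` A)) -> measurable_fun setT f.
Proof.
move=> mG _ B mB; rewrite setTI.
suff : <<s G >> `<=` [set A | measurable (f @^-1` A)] by exact.
apply: smallest_sub => //; split.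
- by rewrite /= preimage_set0.
- by move=> A /= mA; rewrite setTD preimage_setC; exact: measurableC.
- by move=> F mF /=; rewrite preimage_bigcup; exact: bigcupT_measurable.
Qed.

Lemma g_sigma_gen (U : pointedType) (G : set (set U)) A :
  G A -> measurable (A : set (g_sigma_algebraType G)).
Proof. exact: sub_gen_smallest. Qed.

Lemma continuous_borel (T U : ptopologicalType) (f : T -> U) :
  continuous f -> measurable_fun setT (f : borel T -> borel U).
Proof.
move=> /continuousP cf; apply: measurable_g_sigma => A oA.
by apply: g_sigma_gen; exact: cf.
Qed.

Section lebesgue_rV.
Context {R : realType}.

Definition cons_rV n (p : R * 'rV[R]_n) : 'rV[R]_n.+1 :=
  \row_j (if unlift ord0 j is Some k then p.2 ord0 k else p.1).

Definition uncons_rV n (v : 'rV[R]_n.+1) : R * 'rV[R]_n :=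
  (v ord0 ord0, \row_j v ord0 (lift ord0 j)).

Lemma cons_rV0 n (p : R * 'rV[R]_n) : cons_rV p ord0 ord0 = p.1.
Proof. by rewrite mxE unlift_none. Qed.

Lemma cons_rVS n (p : R * 'rV[R]_n) j :
  cons_rV p ord0 (lift ord0 j) = p.2 ord0 j.
Proof. by rewrite mxE liftK. Qed.

Lemma cons_rVK n : cancel (@cons_rV n) (@uncons_rV n).
Proof.
move=> [x v]; congr (_, _); first by rewrite cons_rV0.
by apply/rowP => j; rewrite mxE cons_rVS.
Qed.

Lemma uncons_rVK n : cancel (@uncons_rV n) (@cons_rV n).
Proof.
move=> v; apply/rowP => j; case: (unliftP ord0 j) => [i ->|->].
  by rewrite cons_rVS mxE.
by rewrite cons_rV0.
Qed.

Lemma ball_rV_open n (v : 'rV[R]_n) e : open (ball v e).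
Proof.
have [e0|e0] := ltP 0 e; first exact: ball_open.
rewrite (_ : ball v e = set0); first exact: open0.
by apply/seteqP; split => // x []; rewrite ltNge e0.
Qed.

Lemma cons_rV_ball n (v : 'rV[R]_n.+1) e :
  @cons_rV n @^-1` ball v e =
    ball (uncons_rV v).1 e `*` ball (uncons_rV v).2 e.
Proof.
apply/seteqP; split => [[x w] [/= e0 h]|[x w] [/= h1 [e0 h2]]]; last first.
  split=> // i j; rewrite [i]ord1; case: (unliftP ord0 j) => [k ->|->].
    by rewrite cons_rVS; have := h2 ord0 k; rewrite mxE.
  by rewrite cons_rV0.
split => /=; first by have := h ord0 ord0; rewrite cons_rV0.
split => // i j; rewrite [i]ord1 mxE.
by have := h ord0 (lift ord0 j); rewrite cons_rVS.
Qed.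

Lemma open_rV_bigcup n (U : set 'rV[R]_n) : open U ->
  U = \bigcup_(qk in [set qk : 'rV[rat]_n * nat |
        ball (map_mx ratr qk.1 : 'rV[R]_n) qk.2.+1%:R^-1 `<=` U])
        ball (map_mx ratr qk.1 : 'rV[R]_n) qk.2.+1%:R^-1.
Proof.
move=> oU; apply/seteqP; split => [v Uv|v [qk /= sU]]; last exact: sU.
have /nbhs_ballP[e /= e0 beU] : nbhs v U by exact: open_nbhs_nbhs.
pose k := Num.bound (2 / e).
have ke : 2 * k.+1%:R^-1 < e :> R.
  rewrite ltr_pdivrMr ?ltr0n// mulrC -ltr_pdivrMr//.
  by rewrite (lt_trans (archi_boundP _)) 1?divr_ge0// 1?ltW// ltr_nat.
have k0 : 0 < k.+1%:R^-1 :> R by rewrite invr_gt0 ltr0n.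
set c : R := k.+1%:R^-1 in ke k0.
have /choice[q qv] : forall j : 'I_n, exists q : rat,
    `|ratr q - v ord0 j| < c.
  move=> j.
  have : v ord0 j - c < v ord0 j + c by rewrite ltrD2l gtrN.
  move=> /rat_in_itvoo[q]; rewrite in_itv/= => /andP[q1 q2].
  by exists q; rewrite ltr_distl q1.
have bv : ball (map_mx ratr (\row_j q j) : 'rV[R]_n) c v.
  by split=> // i j; rewrite ord1 !mxE; exact: qv.
exists (\row_j q j, k) => //= w bw; apply: beU.
apply: (@le_ball _ _ _ (c + c)); first by lra.
by apply: ball_triangle bw; exact/ball_sym.
Qed.

Lemma measurable_cons_rV n :
  measurable_fun setT
    (@cons_rV n : (R * borel 'rV[R]_n)%type -> borel 'rV[R]_n.+1).
Proof.
apply: measurable_g_sigma => U /open_rV_bigcup ->.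
rewrite preimage_bigcup bigcup_mkcond; apply: countable_bigcupT_measurable.
  exact: countableP.
move=> [q k]; case: ifPn => // _; rewrite cons_rV_ball; apply: measurableX.
  by apply: open_measurable; exact: ball_open.
by apply: g_sigma_gen; exact: ball_rV_open.
Qed.

Lemma measurable_uncons_rV n :
  measurable_fun setT
    (@uncons_rV n : borel 'rV[R]_n.+1 -> (R * borel 'rV[R]_n)%type).
Proof.
apply/measurable_fun_pairP; split.
  apply: (measurability _ (RGenOpens.measurableE R)).
  move=> _ [_ [a [b ->] <-]]; rewrite setTI; apply: g_sigma_gen.
  move/continuousP: (@coord_continuous R 1 n.+1 ord0 ord0); apply.
  exact: interval_open.
apply: continuous_borel => v U /= /nbhs_ballP[e e0 eU].
apply/nbhs_ballP; exists e => // w [_ vw]; apply: eU; split => // i j.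
by rewrite !mxE; exact: vw.
Qed.

Section cons_measure.
Variables (n : nat)
  (m : {sigma_finite_measure set (borel 'rV[R]_n) -> \bar R}).
Local Open Scope ereal_scope.

Definition cons_measure : set (borel 'rV[R]_n.+1) -> \bar R :=
  pushforward (@lebesgue_measure R \x m)
    (@cons_rV n : (R * borel 'rV[R]_n)%type -> borel 'rV[R]_n.+1).

Let cons_measure0 : cons_measure set0 = 0.
Proof. by rewrite /cons_measure /pushforward preimage_set0 measure0. Qed.

Let cons_measure_ge0 (A : set (borel 'rV[R]_n.+1)) : 0 <= cons_measure A.
Proof. by rewrite /cons_measure /pushforward measure_ge0. Qed.

Let cons_measure_sigma_additive : semi_sigma_additive cons_measure.
Proof.
move=> F mF tF mUF; rewrite /cons_measure /pushforward preimage_bigcup.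
have mc (A : set (borel 'rV[R]_n.+1)) : measurable A ->
    measurable (@cons_rV n @^-1` A : set (R * borel 'rV[R]_n)%type).
  by move=> mA; rewrite -[X in measurable X]setTI; exact: measurable_cons_rV.
apply: measure_semi_sigma_additive => [k||]; first exact: mc.
- apply/trivIsetP => i j _ _ ij; rewrite -preimage_setI.
  by move/trivIsetP : tF => /(_ _ _ _ _ ij) ->//; rewrite preimage_set0.
- by rewrite -preimage_bigcup; exact: mc.
Qed.

HB.instance Definition _ := isMeasure.Build _ _ _ cons_measure
  cons_measure0 cons_measure_ge0 cons_measure_sigma_additive.

Let cons_measure_sigma_finite : sigma_finite setT cons_measure.
Proof.
have /sigma_finiteP[F [TF ndF Foo]] := sigma_finiteT (@lebesgue_measure R).
have /sigma_finiteP[G [TG ndG Goo]] := sigma_finiteT m.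
exists (fun k => @uncons_rV n @^-1` (F k `*` G k)).
  apply/esym; rewrite -subTset => v _.
  have [i _ Fi] : (\bigcup_i F i) (uncons_rV v).1 by rewrite -TF.
  have [j _ Gj] : (\bigcup_i G i) (uncons_rV v).2 by rewrite -TG.
  exists (maxn i j) => //; split.
    by move: Fi; exact/subsetPset/ndF/leq_maxl.
  by move: Gj; exact/subsetPset/ndG/leq_maxr.
move=> k; have [mF Fk] := Foo k; have [mG Gk] := Goo k; split.
  rewrite -[X in measurable X]setTI; apply: measurable_uncons_rV => //.
  exact: measurableX.
rewrite /cons_measure /pushforward -comp_preimage.
rewrite (_ : _ \o _ = id); last by apply/funext => p /=; rewrite cons_rVK.
by rewrite preimage_id product_measure1E// lte_mul_pinfty// ge0_fin_numE.
Qed.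

HB.instance Definition _ := Measure_isSigmaFinite.Build _ _ _ cons_measure
  cons_measure_sigma_finite.

End cons_measure.

(* d-dimensional Lebesgue measure on the Borel sets of R^d: the library only has
   the one-dimensional one, so take iterated products; see [lebesgue_rV_box]. *)
Fixpoint lebesgue_rV n :
    {sigma_finite_measure set (borel 'rV[R]_n) -> \bar R} :=
  match n with
  | 0 => dirac (0 : borel 'rV[R]_0)
  | n'.+1 => cons_measure (lebesgue_rV n')
  end.

Lemma lebesgue_rV_box n (a b : 'rV[R]_n) :
  (forall i, a ord0 i <= b ord0 i) ->
  lebesgue_rV n [set v | forall i, a ord0 i <= v ord0 i <= b ord0 i] =
    (\prod_i (b ord0 i - a ord0 i))%:E.
Proof.
elim: n a b => [|n IH] a b ab.
  rewrite big_ord0 /= diracE mem_set// => -[].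
  by case.
have step : @cons_rV n @^-1`
      [set v | forall i, a ord0 i <= v ord0 i <= b ord0 i] =
    `[a ord0 ord0, b ord0 ord0] `*`
    [set v : 'rV[R]_n | forall i,
      (uncons_rV a).2 ord0 i <= v ord0 i <= (uncons_rV b).2 ord0 i].
  apply/seteqP; split => [[x v]/= h|[x v]/= [hx hv] i].
    split; first by have := h ord0; rewrite cons_rV0 in_itv.
    by move=> i; have := h (lift ord0 i); rewrite cons_rVS !mxE.
  case: (unliftP ord0 i) => [k ->|->].
    by have := hv k; rewrite cons_rVS !mxE.
  by move: hx; rewrite in_itv cons_rV0.
have cbox : closed [set v : 'rV[R]_n | forall i,
    (uncons_rV a).2 ord0 i <= v ord0 i <= (uncons_rV b).2 ord0 i].
  rewrite [X in closed X](_ : _ = \bigcap_(i : 'I_n)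
      ((fun v : 'rV[R]_n => v ord0 i) @^-1`
        `[(uncons_rV a).2 ord0 i, (uncons_rV b).2 ord0 i])); last first.
    apply/seteqP; split => [v h i _ /=|v h i]; first by rewrite in_itv/= h.
    by have := h i I; rewrite /= in_itv.
  apply: closed_bigI => i _; apply: closed_comp => [v _|].
    exact: coord_continuous.
  exact: interval_closed.
have mbox : measurable ([set v | forall i,
    (uncons_rV a).2 ord0 i <= v ord0 i <= (uncons_rV b).2 ord0 i]
    : set (borel 'rV[R]_n)).
  rewrite -[X in measurable X]setCK; apply: measurableC; apply: g_sigma_gen.
  exact: closed_openC.
rewrite /= /cons_measure /pushforward step product_measure1E//=.
rewrite lebesgue_measure_itv/= lte_fin big_ord_recl.
have hlen : (if a ord0 ord0 < b ord0 ord0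
    then ((b ord0 ord0)%:E - (a ord0 ord0)%:E)%E else 0%E) =
  (b ord0 ord0 - a ord0 ord0)%:E.
  have := ab ord0; rewrite le_eqVlt => /orP[/eqP ->|->]; last by rewrite EFinB.
  by rewrite ltxx subrr.
rewrite hlen IH; first by rewrite EFinM; under eq_bigr do rewrite !mxE.
by move=> i; rewrite !mxE.
Qed.

End lebesgue_rV.

Section HellingerKantorovich.
Context {R : realType} {d : nat} {Omega : set 'rV[R]_d}.

(* The subspace Omega as a type.  The proof that it is inhabited is carried along
   only because measurable types are pointed. *)
Definition domain (Omega_ne : Omega !=set0) : Type := Omega.

HB.instance Definition _ Omega_ne := Topological.copy (domain Omega_ne) Omega.
HB.instance Definition _ Omega_ne := isPointed.Build (domain Omega_ne)
  (SigSub (mem_set (projT2 (cid Omega_ne)))).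

Definition eucl_dist (x y : 'rV[R]_d) : R :=
  Num.sqrt (\sum_i (x ord0 i - y ord0 i) ^+ 2).

Definition cos_pi (L : R) : R := cos (Num.min L pi).

Variable Omega_ne : Omega !=set0.
Local Notation dom := (domain Omega_ne).

Definition embed : dom -> 'rV[R]_d := set_val.

(* The cone (Omega x [0, +oo[) / (Omega x {0}). *)
Definition cone_equiv : rel (dom * {nonneg R}) := fun p q =>
  (p == q) || (p.2%:num == 0) && (q.2%:num == 0).

Lemma cone_equiv_refl : reflexive cone_equiv.
Proof. by move=> p; rewrite /cone_equiv eqxx. Qed.

Lemma cone_equiv_sym : symmetric cone_equiv.
Proof. by move=> p q; rewrite /cone_equiv eq_sym andbC. Qed.

Lemma cone_equiv_trans : transitive cone_equiv.
Proof.
move=> q p r; rewrite /cone_equiv.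
move=> /orP[/eqP->//|/andP[p0 q0]] /orP[/eqP<-|/andP[_ r0]].
  by rewrite p0 q0 orbT.
by rewrite p0 r0 orbT.
Qed.

Canonical cone_equiv_equiv :=
  EquivRel cone_equiv cone_equiv_refl cone_equiv_sym cone_equiv_trans.

Definition cone : Type := {eq_quot cone_equiv}%qT.

HB.instance Definition _ := Choice.on cone.
HB.instance Definition _ := Quotient.on cone.
HB.instance Definition _ := isPointed.Build cone (\pi_cone%qT (point, 0%:nng)).

(* [cone_pt x r] is the point [x, r] of the cone.  The base point of the apex is
   arbitrary; its radius is 0. *)
Definition cone_pt (x : dom) (r : {nonneg R}) : cone := \pi_cone%qT (x, r).
Definition cone_base (p : cone) : dom := (repr p).1.
Definition cone_radius (p : cone) : R := (repr p).2%:num.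

Lemma repr_cone_pt x r :
  repr (cone_pt x r) = (x, r) \/
  r%:num = 0 /\ (repr (cone_pt x r)).2%:num = 0.
Proof.
have : (repr (cone_pt x r) = (x, r) %[mod cone])%qT by rewrite reprK.
by move=> /eqmodP/orP[/eqP->|/andP[/eqP-> /eqP]/=]; [left|right].
Qed.

Definition cone_dist (p q : cone) : R :=
  Num.sqrt (cone_radius p ^+ 2 + cone_radius q ^+ 2 -
    2 * cone_radius p * cone_radius q *
    cos_pi (eucl_dist (embed (cone_base p)) (embed (cone_base q)))).

Lemma radius_cone_pt x r : cone_radius (cone_pt x r) = r%:num.
Proof. by rewrite /cone_radius; have [->//|[-> ->]] := repr_cone_pt x r. Qed.

Lemma cone_dist_pt x r y s :
  cone_dist (cone_pt x r) (cone_pt y s) =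
  Num.sqrt (r%:num ^+ 2 + s%:num ^+ 2 -
    2 * r%:num * s%:num * cos_pi (eucl_dist (embed x) (embed y))).
Proof.
rewrite /cone_dist !radius_cone_pt /cone_base.
have [->|[-> _]] := repr_cone_pt x r; last by rewrite mulr0 !mul0r.
by have [->//|[-> _]] := repr_cone_pt y s; rewrite mulr0 !mul0r.
Qed.

(* The open sets of the metric space (cone, cone_dist). *)
Definition cone_open : set (set cone) := [set U |
  forall p, U p -> exists2 e : R, 0 < e & forall q, cone_dist p q < e -> U q].

Local Notation coneB := (g_sigma_algebraType cone_open).

Local Open Scope ereal_scope.

Definition M_Omega := {finite_measure set (borel dom) -> \bar R}.

Definition M_cone := {finite_measure set coneB -> \bar R}.

Definition M2_cone : set M_cone :=
  [set lam : M_cone | \int[lam]_p (cone_radius p ^+ 2)%:E < +oo].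

(* The cone is separable, so the product sigma-algebra used here is the Borel
   sigma-algebra of the product. *)
Definition coupling (lam0 lam1 : M_cone) :
    set {measure set (coneB * coneB)%type -> \bar R} :=
  [set gam | forall A : set coneB, measurable A ->
    gam (A `*` setT) = lam0 A /\ gam (setT `*` A) = lam1 A].

(* There is no coupling when the masses differ, and the infimum is then +oo. *)
Definition W_cone (lam0 lam1 : M_cone) : \bar R :=
  sqrte (ereal_inf
    [set \int[gam]_pq ((cone_dist pq.1 pq.2) ^+ 2)%:E |
      gam in coupling lam0 lam1]).

(* [hproj lam mu] is the defining relation of mu = P lam; it determines mu. *)
Definition hproj (lam : M_cone) (mu : M_Omega) :=
  forall phi : dom -> R, continuous phi ->
    \int[mu]_x (phi x)%:E =
    \int[lam]_p (cone_radius p ^+ 2 * phi (cone_base p))%:E.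

(* The infimum is attained (so it is a minimum), and it is finite. *)
Definition HK (mu0 mu1 : M_Omega) : \bar R :=
  ereal_inf [set w | exists lam0 lam1,
    [/\ M2_cone lam0, M2_cone lam1, hproj lam0 mu0, hproj lam1 mu1 &
        w = W_cone lam0 lam1]].

(* Only the values of the curve on [0, 1] matter. *)
Definition geodesic_curve (mu : R -> M_Omega) :=
  forall s t : R, (0 <= s <= 1)%R -> (0 <= t <= 1)%R ->
    HK (mu s) (mu t) = `|s - t|%:E * HK (mu 0%R) (mu 1%R).

Definition geodesically_convex (Lambda : R) (F : M_Omega -> \bar R) :=
  forall mu : R -> M_Omega, geodesic_curve mu ->
  forall s : R, (0 <= s <= 1)%R ->
    F (mu s) <= (1 - s)%:E * F (mu 0%R) + s%:E * F (mu 1%R)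
      - (Lambda * (s * (1 - s) / 2))%:E * HK (mu 0%R) (mu 1%R) ^+ 2.

Lemma measurable_embed :
  measurable_fun setT (embed : borel dom -> borel 'rV[R]_d).
Proof. by apply: continuous_borel; exact: initial_continuous. Qed.

(* mu seen as a measure on R^d *)
Section extend.
Variable mu : M_Omega.

Definition extend : set (borel 'rV[R]_d) -> \bar R :=
  pushforward mu (embed : borel dom -> borel 'rV[R]_d).

Let mE (A : set (borel 'rV[R]_d)) :
  measurable A -> measurable (embed @^-1` A : set (borel dom)).
Proof.
by move=> mA; rewrite -[X in measurable X]setTI; exact: measurable_embed.
Qed.

Let extend0 : extend set0 = 0.
Proof. by rewrite /extend /pushforward preimage_set0 measure0. Qed.

Let extend_ge0 (A : set (borel 'rV[R]_d)) : 0 <= extend A.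
Proof. by rewrite /extend /pushforward measure_ge0. Qed.

Let extend_sigma_additive : semi_sigma_additive extend.
Proof.
move=> F mF tF mUF; rewrite /extend /pushforward preimage_bigcup.
apply: measure_semi_sigma_additive => [k||]; first exact: mE.
- apply/trivIsetP => i j _ _ ij; rewrite -preimage_setI.
  by move/trivIsetP : tF => /(_ _ _ _ _ ij) ->//; rewrite preimage_set0.
- by rewrite -preimage_bigcup; exact: mE.
Qed.

HB.instance Definition _ := isMeasure.Build _ _ _ extend
  extend0 extend_ge0 extend_sigma_additive.

Let extend_finite : fin_num_fun extend.
Proof. by move=> A mA; apply: fin_num_measure; exact: mE. Qed.

HB.instance Definition _ := Measure_isFinite.Build _ _ _ extend extend_finite.

End extend.

(* [ln 0 = 0], hence [F_B 0 = 1]. *)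
Definition F_B (z : R) : R := (z * ln z - z + 1)%R.

Local Open Scope charge_scope.

Definition log_entropy (mu : M_Omega) : \bar R :=
  if pselect (extend mu `<< lebesgue_rV d) then
    \int[lebesgue_rV d]_(x in (Omega : set (borel 'rV[R]_d)))
      (F_B (fine
        (('d (charge_of_finite_measure (extend mu)) '/d (lebesgue_rV d)) x)))%:E
  else +oo.

End HellingerKantorovich.

Lemma interior_nonempty {T : topologicalType} (A : set T) :
  A° !=set0 -> A !=set0.
Proof. by move=> [x /interior_subset]; exists x. Qed.

(* Main.v *)
(* The entropy fails to be semiconvex along the rays through the null measure.
   For every finite measure m the curve s |-> s^2 m is a geodesic: lifting s^2 m
   to the radius s over m gives HK(s^2 m, t^2 m) <= |s - t| sqrt(m(Omega)), and
   the reverse inequality is d_C >= |r_0 - r_1| together with Cauchy-Schwarz,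
   because the second radial moment of a lift is the mass of its projection.
   For m = c dx on Omega the entropy of s^2 m is |Omega| F_B(s^2 c), whose term
   c s^2 ln(s^2) has second derivative tending to minus infinity at s = 0.
   With c = exp(Lambda / 2) / 4 and s = 1/2, the entropy exceeds the bound
   required by Lambda-convexity by c |Omega| / 4. *)

Require Import Defs.
From HB Require Import structures.
From mathcomp Require Import all_boot all_order all_algebra.
From mathcomp Require Import ring lra.
From mathcomp Require Import all_classical all_reals all_analysis.
From mathcomp Require Import measurable_realfun.

Set Implicit Arguments.
Unset Strict Implicit.
Unset Printing Implicit Defensive.
Import Order.TTheory GRing.Theory Num.Theory.
Import numFieldNormedType.Exports.
Import HBNNSimple.
Local Open Scope classical_set_scope.
Local Open Scope ring_scope.

(** * Images of measures under measurable maps *)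

Section image_measure.
Context d1 d2 (T1 : measurableType d1) (T2 : measurableType d2) (R : realType).
Variables (f : T1 -> T2) (mf : measurable_fun setT f).
Local Open Scope ereal_scope.

(* The library's [pushforward] is a measure only given a proof that [f] is
   measurable, which canonical structure inference cannot guess. *)
Definition image_measure (m : set T1 -> \bar R) (_ : measurable_fun setT f) :
  set T2 -> \bar R := pushforward m f.

Let mpreimage A : measurable A -> measurable (f @^-1` A).
Proof. by move=> mA; rewrite -[X in measurable X]setTI; exact: mf. Qed.

Section measure.
Variable m : {measure set T1 -> \bar R}.

Let image_measure0 : image_measure m mf set0 = 0.
Proof. by rewrite /image_measure /pushforward preimage_set0 measure0. Qed.

Let image_measure_ge0 A : 0 <= image_measure m mf A.
Proof. exact: measure_ge0. Qed.

Let image_measure_sigma_additive : semi_sigma_additive (image_measure m mf).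
Proof.
move=> F mF tF mUF; rewrite /image_measure /pushforward preimage_bigcup.
apply: measure_semi_sigma_additive => [k||]; first exact: mpreimage.
- apply/trivIsetP => i j _ _ ij; rewrite -preimage_setI.
  by move/trivIsetP : tF => /(_ _ _ _ _ ij) ->//; rewrite preimage_set0.
- by rewrite -preimage_bigcup; exact: mpreimage.
Qed.

HB.instance Definition _ := isMeasure.Build _ _ _ (image_measure m mf)
  image_measure0 image_measure_ge0 image_measure_sigma_additive.

End measure.

Section finite_measure.
Variable m : {finite_measure set T1 -> \bar R}.

Let image_measure_finite : fin_num_fun (image_measure m mf).
Proof. by move=> A mA; apply: fin_num_measure; exact: mpreimage. Qed.

HB.instance Definition _ :=
  Measure_isFinite.Build _ _ _ (image_measure m mf) image_measure_finite.

End finite_measure.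

Lemma ge0_integral_image_measure (m : {measure set T1 -> \bar R})
    (g : T2 -> \bar R) : measurable_fun setT g -> (forall y, 0 <= g y) ->
  \int[image_measure m mf]_y g y = \int[m]_x g (f x).
Proof.
by move=> mg g0; rewrite ge0_integral_pushforward.
Qed.

End image_measure.

(* Measurability of [cone_dist] for the product sigma-algebra would require the
   separability of the cone. It is avoided by comparing integrals of arbitrary
   nonnegative functions, as suprema over simple functions. *)
Section nonmeasurable.
Local Open Scope ereal_scope.

Lemma ge0_le_integral_nonmeasurable dsp (T : measurableType dsp) (R : realType)
    (m : {measure set T -> \bar R}) (f g : T -> \bar R) :
  (forall x, 0 <= f x) -> (forall x, f x <= g x) ->
  \int[m]_x f x <= \int[m]_x g x.
Proof.
move=> f0 fg; rewrite !ge0_integralTE//; last first.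
  by move=> x; exact: le_trans (fg x).
apply: ereal_sup_le => _ [h /= hf <-]; exists h => //= x.
exact: le_trans (fg x).
Qed.

(** A simple function below [f] pulls back along [phi] to one below [f \o phi]. Only this inequality
    survives for nonmeasurable [f]: [T1] may carry simple functions below [f \o phi] that do not
    factor through [phi]. It is the direction that bounds a transport cost from above. *)
Lemma ge0_le_integral_image_nonmeasurable d1 d2 (T1 : measurableType d1)
    (T2 : measurableType d2) (R : realType) (m : {measure set T1 -> \bar R})
    (phi : T1 -> T2) (mphi : measurable_fun setT phi) (f : T2 -> \bar R) :
  (forall y, 0 <= f y) ->
  \int[image_measure m mphi]_y f y <= \int[m]_x f (phi x).
Proof.
move=> f0; rewrite (ge0_integralTE (image_measure m mphi))//.
apply: ge_ereal_sup => _ [h /= hf <-].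
rewrite -integralT_nnsfun ge0_integral_image_measure; last 2 first.
- exact/measurable_EFinP.
- by move=> y; rewrite lee_fin.
by apply: ge0_le_integral_nonmeasurable => x; [rewrite /= lee_fin|exact: hf].
Qed.

End nonmeasurable.

(** * Metric and measurable structure of the cone *)

Section cone.
Context (R : realType) (d : nat) (Omega : set 'rV[R]_d).
Variable Omega_ne : Omega !=set0.
Local Notation dom := (domain Omega_ne).
Local Notation cone := (cone Omega_ne).
Local Notation coneB := (g_sigma_algebraType (@cone_open R d Omega Omega_ne)).
Implicit Types p q : cone.

Lemma cos_pi0 : cos_pi (0 : R) = 1.
Proof. by rewrite /cos_pi min_l ?cos0// pi_ge0. Qed.

Lemma cos_pi_le1 (L : R) : cos_pi L <= 1.
Proof. exact: cos_le1. Qed.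

Lemma cos_pi_le (del L : R) : 0 <= del <= pi -> del <= L -> cos_pi L <= cos del.
Proof.
move=> /andP[d0 dpi] dL; rewrite /cos_pi.
have : del <= Num.min L pi by rewrite le_min dL.
rewrite le_eqVlt => /orP[/eqP<-//|lt]; apply: ltW.
by rewrite ltr_cos// in_itv/= ?d0// (le_trans d0 (ltW lt))/= ge_min lexx orbT.
Qed.

Lemma eucl_distxx (x : 'rV[R]_d) : eucl_dist x x = 0.
Proof.
rewrite /eucl_dist big1 ?sqrtr0// => i _.
by rewrite subrr expr0n.
Qed.

Lemma coord_le_eucl_dist (x y : 'rV[R]_d) i :
  `|x ord0 i - y ord0 i| <= eucl_dist x y.
Proof.
rewrite /eucl_dist -sqrtr_sqr ler_wsqrtr// (bigD1 i)//= lerDl sumr_ge0// => j _.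
exact: sqr_ge0.
Qed.

Lemma continuous_eucl_dist (x : 'rV[R]_d) : continuous (eucl_dist x).
Proof.
move=> y; apply: (@continuous_comp _ _ _
  (fun y : 'rV[R]_d => \sum_i (x ord0 i - y ord0 i) ^+ 2)).
  move: y; apply: continuous_big => [|i _ y]; first exact: add_continuous.
  apply: (@continuous_comp _ _ _ (fun y : 'rV[R]_d => y ord0 i)
    (fun z : R => (x ord0 i - z) ^+ 2)); first exact: coord_continuous.
  apply: (@continuous_comp _ _ _ (fun z : R => x ord0 i - z)
    (fun z : R => z ^+ 2)); last exact: exprn_continuous.
  by apply: cvgB; [exact: cvg_cst|exact: cvg_id].
exact: sqrt_continuous.
Qed.

Lemma continuous_cos_pi : continuous (@cos_pi R).
Proof.
move=> L; apply: (@continuous_comp _ _ _ (fun L : R => Num.min L pi) cos).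
  by apply: continuous_min => //; exact: cvg_cst.
exact: continuous_cos.
Qed.

Lemma cone_radius_ge0 p : 0 <= cone_radius p.
Proof. by rewrite /cone_radius. Qed.

(** This form separates the radial part from an angular part that is nonnegative because the cosine
    is at most 1. Dropping the angular part bounds the distance below by the difference of the
    radii. *)
Lemma cone_dist_sqr p q : cone_dist p q ^+ 2 =
  (cone_radius p - cone_radius q) ^+ 2 + 2 * cone_radius p * cone_radius q *
    (1 - cos_pi (eucl_dist (embed (cone_base p)) (embed (cone_base q)))).
Proof.
rewrite /cone_dist; set L := cos_pi _.
have p0 := cone_radius_ge0 p; have q0 := cone_radius_ge0 q.
have L1 : 0 <= 1 - L by rewrite subr_ge0 cos_pi_le1.
rewrite sqr_sqrtr; first by ring.
have -> : cone_radius p ^+ 2 + cone_radius q ^+ 2 -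
    2 * cone_radius p * cone_radius q * L =
    (cone_radius p - cone_radius q) ^+ 2 +
    2 * (cone_radius p * cone_radius q * (1 - L)) by ring.
by rewrite addr_ge0 ?sqr_ge0// mulr_ge0// mulr_ge0// mulr_ge0.
Qed.

Lemma cone_dist_ge_sqr p q :
  (cone_radius p - cone_radius q) ^+ 2 <= cone_dist p q ^+ 2.
Proof.
by rewrite cone_dist_sqr lerDl !mulr_ge0 ?cone_radius_ge0// subr_ge0 cos_pi_le1.
Qed.

Lemma cone_radius_lipschitz p q :
  `|cone_radius p - cone_radius q| <= cone_dist p q.
Proof.
rewrite -(@ler_pXn2r _ 2)// ?nnegrE ?sqrtr_ge0//.
by rewrite real_normK ?num_real// cone_dist_ge_sqr.
Qed.

Lemma domain_nbhs_eucl (x : dom) (V : set dom) : nbhs x V ->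
  exists2 del : R, 0 < del &
    forall y, eucl_dist (embed x) (embed y) < del -> V y.
Proof.
move=> [U [[W oW <-] /= Wx WV]].
have /nbhs_ballP[e /= e0 eW] : nbhs (embed x) W by exact: open_nbhs_nbhs.
exists e => // y xy; apply: WV; apply: eW; split => // i j.
by rewrite [i]ord1; apply: le_lt_trans xy; exact: coord_le_eucl_dist.
Qed.

(** Away from the apex a small cone distance forces a small angle: the angular term of the squared
    distance carries the product of the radii, which stays bounded away from 0. *)
Lemma cone_base_continuous p (V : set dom) : 0 < cone_radius p ->
  nbhs (cone_base p) V -> exists2 e : R, 0 < e & forall q, cone_dist p q < e ->
    0 < cone_radius q /\ V (cone_base q).
Proof.
move=> r0 /domain_nbhs_eucl[del' del'0 delV].
(* The cap at [pi] keeps [del] where the cosine is strictly decreasing, so that [cos del < 1]. *)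
pose del := Num.min del' pi.
have del0 : 0 < del by rewrite lt_min del'0 pi_gt0.
have eta0 : 0 < 1 - cos del.
  rewrite subr_gt0 -(@cos0 R) (@ltr_cos R)// in_itv/= ?lexx ?pi_ge0//.
  by rewrite ltW//= ge_min lexx orbT.
set r := cone_radius p in r0 *.
(* The first bound keeps the radius of [q] above [r / 2]. If the bases were at least [del] apart,
   the angular term would then be at least [2 * r * (r / 2) * (1 - cos del)], the square of the
   second bound. *)
exists (Num.min (r / 2) (r * Num.sqrt (1 - cos del))).
  by rewrite lt_min divr_gt0//= mulr_gt0// sqrtr_gt0.
move=> q; rewrite lt_min => /andP[d1 d2].
have rq : r / 2 < cone_radius q.
  have := le_lt_trans (cone_radius_lipschitz p q) d1.
  by rewrite -/r ltr_distl => /andP[]; lra.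
split; first by apply: lt_trans rq; rewrite divr_gt0.
apply: delV; rewrite ltNge; apply/negP => delL.
have cL : cos_pi (eucl_dist (embed (cone_base p)) (embed (cone_base q))) <=
    cos del.
  apply: cos_pi_le; first by rewrite ltW//= ge_min lexx orbT.
  by apply: le_trans delL; rewrite ge_min lexx.
have : cone_dist p q ^+ 2 < (r * Num.sqrt (1 - cos del)) ^+ 2.
  by rewrite ltr_pXn2r// ?nnegrE ?sqrtr_ge0// mulr_ge0 ?sqrtr_ge0 ?ltW.
rewrite cone_dist_sqr exprMn sqr_sqrtr ?ltW// -/r; apply/negP; rewrite -leNgt.
rewrite -[leLHS]add0r lerD ?sqr_ge0// ler_pM ?sqr_ge0 ?(ltW eta0)//.
  by rewrite expr2; nra.
by rewrite lerD2l lerN2.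
Qed.

(** The base of the apex is an arbitrary representative, so [phi] is required to be constant at
    radius 0. Off the apex, base and radius vary continuously, and the apex is a single measurable
    point. *)
Lemma measurable_cone_fun (phi : dom * R -> R) : continuous phi ->
  (forall x y, phi (x, 0) = phi (y, 0)) ->
  measurable_fun setT
    ((fun p => phi (cone_base p, cone_radius p)) : coneB -> R).
Proof.
move=> cphi phi0.
pose g p := phi (cone_base p, cone_radius p).
have opn (B : set R) : open B ->
    cone_open [set p | 0 < cone_radius p /\ B (g p)].
  move=> oB p /= [r0 Bp].
  have : nbhs (cone_base p, cone_radius p) (phi @^-1` B).
    by apply: cphi; exact: open_nbhs_nbhs.
  move=> [[V W] /= [nV nW] VW].
  have [e e0 eV] := cone_base_continuous r0 nV.
  have /nbhs_ballP[e' /= e'0 eW] := nW.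
  exists (Num.min e e'); first by rewrite lt_min e0.
  move=> q; rewrite lt_min => /andP[/eV[q0 Vq] qe'].
  split => //; apply: VW; split => //=; apply: eW.
  by apply: le_lt_trans qe'; exact: cone_radius_lipschitz.
apply: (measurability _ (RGenOpens.measurableE R)).
move=> _ [_ [a [b ->] <-]]; rewrite setTI.
set B := [set` _].
pose x0 : dom := point.
(* The preimage is an open set of points of positive radius, together with the apex when the common
   value of [phi] there lies in [B]. The apex is written as the complement of an instance of [opn]
   with [setT]. *)
have -> : (fun p => phi (cone_base p, cone_radius p)) @^-1` B =
    [set p | 0 < cone_radius p /\ B (g p)] `|`
    (if `[<B (phi (x0, 0))>] then ~` [set p | 0 < cone_radius p /\ setT (g p)]
     else set0).
  apply/seteqP; split => p /=.
    move=> Bp; have := cone_radius_ge0 p; rewrite le_eqVlt => /predU1P[r0|r0].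
      right; case: asboolP => /= [_ []|]; first by rewrite -r0 ltxx.
      by apply; rewrite (phi0 _ (cone_base p)) r0.
    by left.
  move=> [[]//|]; case: asboolP => //= B0 rp.
  have := cone_radius_ge0 p; rewrite le_eqVlt => /predU1P[r0|r0].
    by rewrite -r0 (phi0 _ x0).
  by case: rp.
apply: measurableU.
  by apply: g_sigma_gen; apply: opn; exact: interval_open.
case: ifP => _ //; apply: measurableC; apply: g_sigma_gen; apply: opn.
exact: openT.
Qed.

Lemma measurable_cone_radius :
  measurable_fun setT (@cone_radius R d Omega Omega_ne : coneB -> R).
Proof.
apply: (@measurable_cone_fun snd) => //.
by move=> z; exact: cvg_snd.
Qed.

(** At fixed radius the cone distance is a continuous function of the base points that vanishes on
    the diagonal, so preimages of open sets of the cone are open. *)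
Lemma measurable_cone_pt (r : {nonneg R}) :
  measurable_fun setT ((fun x => cone_pt x r) : borel dom -> coneB).
Proof.
apply: measurable_g_sigma => U oU; apply: g_sigma_gen => /=.
rewrite openE => x /= Ux.
have [e e0 eU] := oU _ Ux.
suff : \forall y \near x, cone_dist (cone_pt x r) (cone_pt y r) < e.
  by apply: filterS => y; exact: eU.
pose f (y : dom) := r%:num ^+ 2 + r%:num ^+ 2 -
    2 * r%:num * r%:num * cos_pi (eucl_dist (embed x) (embed y)).
have cf : {for x, continuous f}.
  apply: (@continuous_comp _ _ _
    (fun y : dom => eucl_dist (embed x) (embed y))
    (fun L => r%:num ^+ 2 + r%:num ^+ 2 - 2 * r%:num * r%:num * cos_pi L)).
    apply: (@continuous_comp _ _ _ (@embed _ _ _ Omega_ne)).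
      exact: initial_continuous.
    exact: continuous_eucl_dist.
  apply: cvgB; first exact: cvg_cst.
  by apply: cvgM; [exact: cvg_cst|exact: continuous_cos_pi].
have f0 : f x = 0 by rewrite /f eucl_distxx cos_pi0; ring.
have csf : {for x, continuous (Num.sqrt \o f)}.
  by apply: continuous_comp; [exact: cf|exact: sqrt_continuous].
have : nbhs ((Num.sqrt \o f) x) [set z | z < e].
  apply: open_nbhs_nbhs; split; first exact: open_lt.
  by rewrite /= f0 sqrtr0.
move/csf => h; apply: (filterS _ (h : nbhs x _)) => y /=.
by rewrite cone_dist_pt.
Qed.

End cone.

(** Optimising over the weight [k] turns the weighted bounds into the Cauchy-Schwarz form: at
    [k = b / a] both weighted terms equal [a * b]. *)
Lemma sqr_sub_le_weighted (R : realFieldType) (a b j : R) : 0 <= a -> 0 <= b ->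
  (forall k, 0 < k -> a ^+ 2 + b ^+ 2 <= j + k * a ^+ 2 + k^-1 * b ^+ 2) ->
  (a - b) ^+ 2 <= j.
Proof.
move=> a0 b0.
(* Exchanging [a] and [b] amounts to replacing [k] by its inverse, so the case [a = 0] reduces to
   [b = 0]. *)
wlog : a b a0 b0 / b = 0 \/ 0 < a /\ 0 < b => [wl h|].
  move: a0; rewrite le_eqVlt => /orP[/eqP a0|a0]; last first.
    move: (b0); rewrite le_eqVlt => /orP[/eqP b0'|b0'].
      by apply: wl => //; [exact: ltW|left].
    by apply: wl => //; [exact: ltW|right].
  rewrite -opprB sqrrN; apply: wl => // [||k k0]; first by rewrite -a0.
    by left.
  have := h k^-1; rewrite invr_gt0 invrK => /(_ k0); lra.
move=> [->|[{}a0 {}b0]] h; last first.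
  have := h (b / a) (divr_gt0 b0 a0).
  have -> : b / a * a ^+ 2 = a * b by field; rewrite gt_eqF.
  have -> : (b / a)^-1 * b ^+ 2 = a * b by field; rewrite !gt_eqF.
  lra.
rewrite subr0 leNgt; apply/negP => ja.
have a2 : 0 < a ^+ 2.
  rewrite lt_neqAle sqr_ge0 andbT; apply/eqP => a2.
  by have := h 1 ltr01; move: ja; rewrite -a2; lra.
(* With [b = 0] no weight is optimal. This one makes the weighted term half the gap [a ^+ 2 - j],
   which contradicts the bound. *)
have k0 : 0 < (a ^+ 2 - j) / (2 * a ^+ 2).
  by rewrite divr_gt0 ?subr_gt0// mulr_gt0.
have := h _ k0.
have -> : (a ^+ 2 - j) / (2 * a ^+ 2) * a ^+ 2 = (a ^+ 2 - j) / 2.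
  by move: (a ^+ 2) a2 => A A0; field; rewrite gt_eqF.
lra.
Qed.

(** * The Hellinger-Kantorovich distance: lower bound by masses *)

Section HellingerKantorovich.
Context (R : realType) (d : nat) (Omega : set 'rV[R]_d).
Variable Omega_ne : Omega !=set0.
Local Notation dom := (domain Omega_ne).
Local Notation cone := (cone Omega_ne).
Local Notation coneB := (g_sigma_algebraType (@cone_open R d Omega Omega_ne)).
Local Open Scope ereal_scope.

Lemma hproj_mass (lam : M_cone Omega_ne) (mu : M_Omega Omega_ne) :
  hproj lam mu -> \int[lam]_p (cone_radius p ^+ 2)%:E = mu setT.
Proof.
move=> /(_ (cst 1%R)) h.
rewrite -[RHS]mul1e -integral_cst// h; last exact: cst_continuous.
by apply: eq_integral => p _; rewrite mulr1.
Qed.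

Lemma measurable_sqr_cone_radius :
  measurable_fun setT ((fun p => cone_radius p ^+ 2)%R : coneB -> R).
Proof. by apply: measurable_funX; exact: measurable_cone_radius. Qed.

Lemma integral_coupling_sqr_radius (lam0 lam1 : M_cone Omega_ne) gam :
  coupling lam0 lam1 gam ->
  \int[gam]_pq (cone_radius pq.1 ^+ 2)%:E =
    \int[lam0]_p (cone_radius p ^+ 2)%:E /\
  \int[gam]_pq (cone_radius pq.2 ^+ 2)%:E =
    \int[lam1]_p (cone_radius p ^+ 2)%:E.
Proof.
move=> cg.
have mr : measurable_fun setT (fun p : coneB => (cone_radius p ^+ 2)%:E).
  by apply/measurable_EFinP; exact: measurable_sqr_cone_radius.
have r0 (p : cone) : 0 <= (cone_radius p ^+ 2)%:E by rewrite lee_fin sqr_ge0.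
split.
- transitivity
    (\int[image_measure gam measurable_fst]_p (cone_radius p ^+ 2)%:E).
    by rewrite (ge0_integral_image_measure measurable_fst).
  apply: eq_measure_integral => A mA _.
  by have [+ _] := cg A mA; rewrite setXT.
- transitivity
    (\int[image_measure gam measurable_snd]_p (cone_radius p ^+ 2)%:E).
    by rewrite (ge0_integral_image_measure measurable_snd).
  apply: eq_measure_integral => A mA _.
  by have [_ +] := cg A mA; rewrite setTX.
Qed.

(** For any coupling this is the reverse triangle inequality in L2 for the two radii, whose L2 norms
    are [a] and [b]. *)
Lemma W_cone_ge (a b : R) (lam0 lam1 : M_cone Omega_ne) :
  (0 <= a)%R -> (0 <= b)%R ->
  \int[lam0]_p (cone_radius p ^+ 2)%:E = (a ^+ 2)%:E ->
  \int[lam1]_p (cone_radius p ^+ 2)%:E = (b ^+ 2)%:E ->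
  `|a - b|%:E <= W_cone lam0 lam1.
Proof.
move=> a0 b0 ha hb; rewrite -abse_EFin -sqrte_sqr lee_sqrt; last first.
  apply/ereal_infP => _ [gam _ <-].
  by apply: integral_ge0 => pq _; rewrite lee_fin sqr_ge0.
apply/ereal_infP => _ [gam cg <-].
have [g0 g1] := integral_coupling_sqr_radius cg.
rewrite ha in g0; rewrite hb in g1.
have mr0 : measurable_fun setT (fun pq : coneB * coneB => cone_radius pq.1).
  exact: (measurableT_comp
    (@measurable_cone_radius _ _ _ Omega_ne) measurable_fst).
have mr1 : measurable_fun setT (fun pq : coneB * coneB => cone_radius pq.2).
  exact: (measurableT_comp
    (@measurable_cone_radius _ _ _ Omega_ne) measurable_snd).
(* Here the cost is replaced by the radial part, a measurable integrand for which additivity of the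
   integral is available. *)
apply: (@le_trans _ _
  (\int[gam]_pq ((cone_radius pq.1 - cone_radius pq.2) ^+ 2)%:E)); last first.
  apply: ge0_le_integral_nonmeasurable => pq; rewrite lee_fin ?sqr_ge0//.
  exact: cone_dist_ge_sqr.
set J := \int[gam]_pq _.
have J0 : 0 <= J by apply: integral_ge0 => pq _; rewrite lee_fin sqr_ge0.
have mf0 : measurable_fun setT
    (fun pq : coneB * coneB => (cone_radius pq.1 ^+ 2)%:E).
  by apply/measurable_EFinP; exact: measurable_funX.
have mf1 : measurable_fun setT
    (fun pq : coneB * coneB => (cone_radius pq.2 ^+ 2)%:E).
  by apply/measurable_EFinP; exact: measurable_funX.
have mf2 : measurable_fun setT
    (fun pq : coneB * coneB => ((cone_radius pq.1 - cone_radius pq.2) ^+ 2)%:E).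
  by apply/measurable_EFinP; apply: measurable_funX; exact: measurable_funB.
have nn0 (pq : coneB * coneB) : [set: coneB * coneB] pq ->
    0 <= (cone_radius pq.1 ^+ 2)%:E.
  by move=> _; rewrite lee_fin sqr_ge0.
have nn1 (pq : coneB * coneB) : [set: coneB * coneB] pq ->
    0 <= (cone_radius pq.2 ^+ 2)%:E.
  by move=> _; rewrite lee_fin sqr_ge0.
have nn2 (pq : coneB * coneB) : [set: coneB * coneB] pq ->
    0 <= ((cone_radius pq.1 - cone_radius pq.2) ^+ 2)%:E.
  by move=> _; rewrite lee_fin sqr_ge0.
(* Integrating a pointwise AM-GM inequality for each weight [k] lets [sqr_sub_le_weighted] finish
   with real numbers. *)
have key k : (0 < k)%R ->
    (a ^+ 2)%:E + (b ^+ 2)%:E <= J + k%:E * (a ^+ 2)%:E + k^-1%:E * (b ^+ 2)%:E.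
  move=> k0; have k1 := ltW k0; have k2 : (0 <= k^-1)%R by rewrite invr_ge0.
  rewrite -g0 -g1 -ge0_integralD// -!ge0_integralZl_EFin//.
  have nk0 (pq : coneB * coneB) : [set: coneB * coneB] pq ->
      0 <= k%:E * (cone_radius pq.1 ^+ 2)%:E.
    by move=> _; rewrite -EFinM lee_fin mulr_ge0// sqr_ge0.
  have nk1 (pq : coneB * coneB) : [set: coneB * coneB] pq ->
      0 <= k^-1%:E * (cone_radius pq.2 ^+ 2)%:E.
    by move=> _; rewrite -EFinM lee_fin mulr_ge0// sqr_ge0.
  have mk0 : measurable_fun setT
      (fun pq : coneB * coneB => k%:E * (cone_radius pq.1 ^+ 2)%:E).
    exact: measurable_funeM.
  have mk1 : measurable_fun setT
      (fun pq : coneB * coneB => k^-1%:E * (cone_radius pq.2 ^+ 2)%:E).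
    exact: measurable_funeM.
  rewrite -!ge0_integralD//; last 2 first.
  - by move=> pq _; rewrite adde_ge0// ?nk0// nn2.
  - exact: emeasurable_funD.
  apply: ge0_le_integral_nonmeasurable => pq; rewrite lee_fin.
    by rewrite addr_ge0 ?sqr_ge0.
  set u := cone_radius _; set v := cone_radius _.
  (* AM-GM: [2 u v <= k u ^+ 2 + v ^+ 2 / k] *)
  have : (0 <= k^-1 * (k * u - v) ^+ 2)%R by rewrite mulr_ge0// sqr_ge0.
  have -> : (k^-1 * (k * u - v) ^+ 2 =
      k * u ^+ 2 - 2 * u * v + k^-1 * v ^+ 2)%R.
    by field; rewrite gt_eqF.
  lra.
case: J J0 key => [j _ key| _ _|//]; last by rewrite leey.
by rewrite lee_fin; apply: sqr_sub_le_weighted => // k /key.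
Qed.

Lemma HK_ge (a b : R) (mu0 mu1 : M_Omega Omega_ne) :
  (0 <= a)%R -> (0 <= b)%R ->
  mu0 setT = (a ^+ 2)%:E -> mu1 setT = (b ^+ 2)%:E -> `|a - b|%:E <= HK mu0 mu1.
Proof.
move=> a0 b0 ha hb; apply/ereal_infP => _ [lam0 [lam1 [_ _ h0 h1 ->]]].
by apply: W_cone_ge => //; [rewrite (hproj_mass h0)|rewrite (hproj_mass h1)].
Qed.

(** * Rays through the null measure are geodesics *)

Section cone_lift.
Variable m : M_Omega Omega_ne.

(** Defined for every real [s], since the curves in [geodesic_curve] are indexed by all of [R]. *)
Definition sqr_nng (s : R) : {nonneg R} := NngNum (sqr_ge0 s).

(** All lifts have the total mass of [m], even at [s = 0], where the null measure is lifted to a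
    mass at the apex. Hence any two of them can be coupled. *)
Definition cone_lift (s : {nonneg R}) : M_cone Omega_ne :=
  image_measure m (@measurable_cone_pt _ _ _ Omega_ne s).

Lemma cone_lift_M2 s : M2_cone (cone_lift s).
Proof.
rewrite /M2_cone /=.
rewrite (ge0_integral_image_measure
  (@measurable_cone_pt _ _ _ Omega_ne s)); last 2 first.
- by apply/measurable_EFinP; exact: measurable_sqr_cone_radius.
- by move=> p; rewrite lee_fin sqr_ge0.
under eq_integral do rewrite radius_cone_pt.
rewrite integral_cst//= -ge0_fin_numE ?mule_ge0 ?lee_fin ?sqr_ge0//.
by rewrite fin_numM// fin_num_measure.
Qed.

(** At [s = 0] the base of the chosen representative may differ from [x], but then both sides
    vanish. *)
Lemma sqr_radius_cone_pt (phi : dom -> R) x (s : {nonneg R}) :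
  (cone_radius (cone_pt x s) ^+ 2 * phi (cone_base (cone_pt x s)) =
   s%:num ^+ 2 * phi x)%R.
Proof.
rewrite radius_cone_pt /cone_base; have [->//|[-> _]] := repr_cone_pt x s.
by rewrite expr0n !mul0r.
Qed.

Lemma cone_lift_hproj s : hproj (cone_lift s) (mscale (sqr_nng s%:num) m).
Proof.
move=> phi cphi.
have mphi : measurable_fun setT (fun x : borel dom => (phi x)%:E).
  apply/measurable_EFinP.
  apply: (measurability _ (RGenOpens.measurableE R)).
  move=> _ [_ [a [b ->] <-]]; rewrite setTI; apply: g_sigma_gen.
  by move/continuousP: cphi; apply; exact: interval_open.
have mg : measurable_fun setT
    (fun p : coneB => (cone_radius p ^+ 2 * phi (cone_base p))%:E).
  apply/measurable_EFinP.
  apply: (@measurable_cone_fun _ _ _ _ (fun z => z.2 ^+ 2 * phi z.1)%R).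
    move=> z; apply: cvgM.
      apply: (@continuous_comp _ _ _ snd (fun r : R => r ^+ 2)%R).
        exact: cvg_snd.
      exact: exprn_continuous.
    by apply: (@continuous_comp _ _ _ fst phi); [exact: cvg_fst|exact: cphi].
  by move=> x y; rewrite /= expr0n !mul0r.
have s2 : (0 <= s%:num ^+ 2)%R by exact: sqr_ge0.
(* Since [phi] may change sign, the change of variables is made for the positive and the negative
   part separately. *)
rewrite integralE [RHS]integralE; congr (_ - _).
- rewrite ge0_integral_mscale//; last exact: measurable_funepos.
  rewrite (ge0_integral_image_measure
    (@measurable_cone_pt _ _ _ Omega_ne s))//; last first.
    exact: measurable_funepos.
  rewrite -ge0_integralZl_EFin//; last exact: measurable_funepos.
  apply: eq_integral => x _.
  rewrite -[LHS]/((fun x : dom => (s%:num ^+ 2)%:E * (EFin \o phi)^\+ x) x).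
  by rewrite -ge0_funeposM// !funeposE sqr_radius_cone_pt EFinM.
- rewrite ge0_integral_mscale//; last exact: measurable_funeneg.
  rewrite (ge0_integral_image_measure
    (@measurable_cone_pt _ _ _ Omega_ne s))//; last first.
    exact: measurable_funeneg.
  rewrite -ge0_integralZl_EFin//; last exact: measurable_funeneg.
  apply: eq_integral => x _.
  rewrite -[LHS]/((fun x : dom => (s%:num ^+ 2)%:E * (EFin \o phi)^\- x) x).
  by rewrite -ge0_funenegM// !funenegE sqr_radius_cone_pt EFinM.
Qed.

(** The coupling moves mass only radially: it is the image of [m] under [x |-> ([x, s], [x, t])],
    along which the squared distance is the constant [(s - t) ^+ 2]. *)
Lemma W_cone_lift_le s t :
  W_cone (cone_lift s) (cone_lift t) <=
    (`|s%:num - t%:num| * Num.sqrt (fine (m setT)))%:E.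
Proof.
have mst : measurable_fun setT
    ((fun x => (cone_pt x s, cone_pt x t)) : borel dom -> (coneB * coneB)%type).
  by apply/measurable_fun_pairP; split; exact: measurable_cone_pt.
have cpl : coupling (cone_lift s) (cone_lift t) (image_measure m mst).
  move=> A mA; split; rewrite /image_measure /pushforward/=; congr (m _).
    by apply/seteqP; split => x //= [].
  by apply/seteqP; split => x //= [].
have M0 : (0 <= fine (m setT))%R by rewrite fine_ge0.
rewrite -sqrtr_sqr -sqrtrM ?sqr_ge0// -[leRHS]/(sqrte (_)%:E).
rewrite lee_sqrt; last by rewrite lee_fin mulr_ge0 ?sqr_ge0.
apply: le_trans (ereal_inf_lbound _) _; first by exists (image_measure m mst).
apply: le_trans (ge0_le_integral_image_nonmeasurable _ mst _) _.
  by move=> pq; rewrite lee_fin sqr_ge0.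
rewrite (eq_integral (cst ((s%:num - t%:num) ^+ 2)%:E)); last first.
  move=> x _ /=; congr EFin; rewrite cone_dist_pt eucl_distxx cos_pi0.
  rewrite sqr_sqrtr; first by ring.
  rewrite (_ : (_ - _ = (s%:num - t%:num) ^+ 2)%R) ?sqr_ge0//; ring.
by rewrite integral_cst//= [leRHS]EFinM fineK// fin_num_measure.
Qed.

Lemma HK_scale (s t : {nonneg R}) :
  HK (mscale (sqr_nng s%:num) m) (mscale (sqr_nng t%:num) m) =
  (`|s%:num - t%:num| * Num.sqrt (fine (m setT)))%:E.
Proof.
have M0 : (0 <= fine (m setT))%R by rewrite fine_ge0.
have mE (k : R) : mscale (sqr_nng k) m setT =
    ((k * Num.sqrt (fine (m setT))) ^+ 2)%:E.
  by rewrite exprMn sqr_sqrtr// EFinM fineK// fin_num_measure.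
apply/eqP; rewrite eq_le; apply/andP; split.
  apply: le_trans (ereal_inf_lbound _) (W_cone_lift_le s t).
  exists (cone_lift s), (cone_lift t); split => //.
  - exact: cone_lift_M2.
  - exact: cone_lift_M2.
  - exact: cone_lift_hproj.
  - exact: cone_lift_hproj.
(* The product becomes a difference of the square roots of the two total masses, as [HK_ge]
   expects. *)
rewrite -[X in (_ * X)%R]ger0_norm ?sqrtr_ge0// -normrM mulrBl.
by apply: HK_ge; [apply: mulr_ge0; rewrite ?sqrtr_ge0
                 |apply: mulr_ge0; rewrite ?sqrtr_ge0|exact: mE|exact: mE].
Qed.

Lemma geodesic_scale :
  geodesic_curve (fun s => mscale (sqr_nng s) m : M_Omega Omega_ne).
Proof.
move=> s t /andP[s0 _] /andP[t0 _].
have h01 : HK (mscale (sqr_nng 0) m) (mscale (sqr_nng 1) m) = _ :=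
  HK_scale (0%:nng)%R (1%:nng)%R.
have hst : HK (mscale (sqr_nng s) m) (mscale (sqr_nng t) m) = _ :=
  HK_scale (NngNum s0) (NngNum t0).
by rewrite h01 hst /= sub0r normrN1 mul1r -EFinM.
Qed.

End cone_lift.

End HellingerKantorovich.

(** * Lebesgue measure of a compact set with interior *)

Section lebesgue.
Context (R : realType) (d : nat).
Local Notation V := 'rV[R]_d.

Lemma closed_box (a b : V) :
  closed [set v : V | forall i, a ord0 i <= v ord0 i <= b ord0 i].
Proof.
rewrite [X in closed X](_ : _ = \bigcap_(i : 'I_d)
    ((fun v : V => v ord0 i) @^-1` `[a ord0 i, b ord0 i])).
  apply: closed_bigI => i _; apply: closed_comp => [v _|].
    exact: coord_continuous.
  exact: interval_closed.
by apply/seteqP; split => v h i; have := h i; rewrite /= in_itv//=; apply.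
Qed.

Lemma closed_borel (A : set V) : closed A -> measurable (A : set (borel V)).
Proof.
move=> cA; rewrite -[X in measurable X]setCK; apply: measurableC.
by apply: g_sigma_gen; exact: closed_openC.
Qed.

Variable Omega : set V.
Hypothesis cOmega : compact Omega.

Lemma compact_borel : measurable (Omega : set (borel V)).
Proof.
apply: closed_borel; apply: compact_closed cOmega.
exact: (@norm_hausdorff R V).
Qed.

Lemma lebesgue_compact_lty : (lebesgue_rV d Omega < +oo)%E.
Proof.
have [M [_ OM]] := compact_bounded cOmega.
(* The norm bound holds for constants strictly above [M]; the maximum with 0 makes the box below
   nonempty. *)
pose K := Num.max 0 (M + 1).
have K0 : 0 <= K by rewrite le_max lexx.
have N0 : 0 <= K + 1 by rewrite addr_ge0.
have ON v i : Omega v -> `|v ord0 i| <= K + 1.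
  move=> Ov; have : ball (0 : V) (K + 1) v.
    rewrite mx_norm_ball /ball_/= sub0r normrN.
    apply: (@le_lt_trans _ _ K); last by rewrite ltrDl.
    by apply: (OM K) => //; rewrite lt_max ltrDl ltr01 orbT.
  by case=> _ /(_ ord0 i); rewrite mxE /ball/= sub0r normrN => /ltW.
pose b : V := const_mx (K + 1).
apply: (@le_lt_trans _ _ (lebesgue_rV d
    [set v : V | forall i, (- b) ord0 i <= v ord0 i <= b ord0 i])).
  apply: le_measure; rewrite ?inE.
  - exact: compact_borel.
  - by apply: closed_borel; exact: closed_box.
  - by move=> v Ov i; rewrite !mxE -ler_norml; exact: ON.
rewrite lebesgue_rV_box ?ltry// => i; rewrite !mxE.
by rewrite (le_trans _ N0)// oppr_le0.
Qed.

(** Balls of row vectors are cubes, so the ball of radius [e] around an interior point contains a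
    closed cube of side [e]. *)
Lemma lebesgue_interior_gt0 : Omega° !=set0 -> (0 < lebesgue_rV d Omega)%E.
Proof.
move=> [v /nbhs_ballP[e /= e0 vO]].
pose c : V := const_mx (e / 2).
apply: (@lt_le_trans _ _ (lebesgue_rV d
    [set w : V | forall i, (v - c) ord0 i <= w ord0 i <= (v + c) ord0 i])).
  rewrite lebesgue_rV_box.
    rewrite lte_fin prodr_gt0// => i _; rewrite !mxE; lra.
  by move=> i; rewrite !mxE; lra.
apply: le_measure; rewrite ?inE.
- by apply: closed_borel; exact: closed_box.
- exact: compact_borel.
- move=> w /= h; apply: vO; split => // i j; rewrite [i]ord1.
  by have := h j; rewrite !mxE /ball/= ltr_distl => /andP[]; lra.
Qed.

End lebesgue.

(** * The entropy of multiples of Lebesgue measure *)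

Section entropy.
Context (R : realType) (d : nat) (Omega : set 'rV[R]_d).
Variables (Omega_ne : Omega !=set0) (cOmega : compact Omega).
Local Notation dom := (domain Omega_ne).
Local Notation V := 'rV[R]_d.

(** A total left inverse of [embed], with default [point] outside [Omega]; it transports the
    restricted Lebesgue measure to the subspace. *)
Definition retract (x : V) : dom := insubd (point : dom) x.

Lemma embed_retract x :
  embed (retract x) = if x \in Omega then x else embed (point : dom).
Proof. exact: val_insubd. Qed.

Lemma retractK x : Omega x -> embed (retract x) = x.
Proof. by move=> Ox; rewrite embed_retract mem_set. Qed.

Lemma measurable_retract : measurable_fun setT (retract : borel V -> borel dom).
Proof.
apply: measurable_g_sigma => _ [W oW <-].
have mO := compact_borel cOmega.
have -> : retract @^-1` (set_val @^-1` W) =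
    (Omega `&` W) `|` (if `[<W (embed (point : dom))>] then ~` Omega else set0).
  apply/seteqP; split => x; rewrite /preimage /= -/(embed _) embed_retract.
    case: ifPn => [/set_mem Ox Wx|/negP Ox Wx]; first by left.
    by right; case: asboolP => // _ Ox'; apply: Ox; exact/mem_set.
  move=> -[[Ox Wx]|]; first by rewrite mem_set.
  by case: asboolP => //= Wp Ox; rewrite memNset.
apply: measurableU; first by apply: measurableI => //; exact: g_sigma_gen.
by case: ifP => // _; exact: measurableC.
Qed.

Definition lebesgue_dom : M_Omega Omega_ne :=
  image_measure (mfrestr (compact_borel cOmega) (lebesgue_compact_lty cOmega))
    measurable_retract.

Local Open Scope ereal_scope.

Lemma lebesgue_domT : lebesgue_dom setT = lebesgue_rV d Omega.
Proof.
by rewrite /= /image_measure /pushforward /mfrestr /mrestr preimage_setT setTI.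
Qed.

Lemma extend_scale (mu : M_Omega Omega_ne) (k : R) (A : set (borel V)) :
  (forall B, mu B = k%:E * lebesgue_dom B) ->
  extend mu A = k%:E * lebesgue_rV d (A `&` Omega).
Proof.
rewrite /extend /pushforward => ->; congr (_ * _).
rewrite /= /image_measure /pushforward /mfrestr /mrestr.
congr (lebesgue_rV d _).
by apply/seteqP; split => x [Ax Ox]; split => //; move: Ax; rewrite /= retractK.
Qed.

Lemma measurable_F_B : measurable_fun setT (@F_B R).
Proof.
apply: measurable_funD => //; apply: measurable_funB => //.
by apply: measurable_funM => //; exact: measurable_ln.
Qed.

(** The density is only determined almost everywhere: it equals [k] a.e. on [Omega], because both
    have the same integral over every measurable subset of [Omega]. *)
Lemma log_entropy_scale (mu : M_Omega Omega_ne) (k : R) :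
  (forall B, mu B = k%:E * lebesgue_dom B) ->
  log_entropy mu = (F_B k)%:E * lebesgue_rV d Omega.
Proof.
move=> muE.
have mO := compact_borel cOmega.
rewrite /log_entropy; case: pselect => [dom|]; last first.
  case; apply/null_content_dominatesP => A mA A0.
  rewrite (extend_scale _ muE); apply/eqP; rewrite mule_eq0; apply/orP; right.
  by rewrite -measure_le0 -A0; exact: measureIl.
set nu := extend _ in dom *.
set f := Radon_Nikodym _ _.
have intf : (lebesgue_rV d).-integrable setT f.
  exact: Radon_Nikodym_integrable.
have mf := measurable_int _ intf.
have fk : ae_eq (lebesgue_rV d) Omega f (cst k%:E).
  apply: integral_ae_eq => //.
    exact: integrableS intf.
  move=> E EO mE; rewrite -Radon_Nikodym_integral// integral_cst//.
  by rewrite [LHS](extend_scale _ muE) setIidl.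
rewrite (ae_eq_integral (cst (F_B k)%:E))//.
- by rewrite integral_cst.
- apply/measurable_EFinP; apply: measurable_funTS.
  apply: (measurableT_comp measurable_F_B).
  by apply: (measurableT_comp _ mf).
- by apply: filterS fk => x /[apply] ->.
Qed.

End entropy.

Theorem mainTheorem15 (R : realType) (d : nat) (Omega : set 'rV[R]_d)
    (Omega_convex : convex_set Omega) (Omega_compact : compact Omega)
    (Omega_interior : Omega° !=set0) (Lambda : R) :
  ~ geodesically_convex Lambda
      (@log_entropy R d Omega (interior_nonempty Omega_interior)).
Proof.
set ne := interior_nonempty _.
(* At [s = 1/2] the entropy exceeds the convexity bound by [c * v / 4] times
   [1 - ln c - ln 4 + Lambda / 2], where [v] is the volume of [Omega]. This [c] makes the factor
   equal to 1. *)
pose c : R := expR (Lambda / 2) / 4.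
have c0 : 0 < c by rewrite divr_gt0// expR_gt0.
pose leb := lebesgue_dom ne Omega_compact.
pose m : M_Omega ne := mscale (NngNum (ltW c0)) leb.
pose v := fine (lebesgue_rV d Omega).
have vE : (lebesgue_rV d Omega = v%:E)%E.
  by rewrite fineK// ge0_fin_numE//; exact: lebesgue_compact_lty.
have v0 : 0 < v by rewrite -lte_fin -vE; exact: lebesgue_interior_gt0.
have mT : m setT = (c * v)%:E.
  by rewrite EFinM -vE -(lebesgue_domT ne Omega_compact).
have EE (s : R) : log_entropy (mscale (sqr_nng s) m : M_Omega ne) =
    (F_B (s ^+ 2 * c) * v)%:E.
  rewrite (@log_entropy_scale _ _ _ _ Omega_compact _ (s ^+ 2 * c)) ?vE//.
  by move=> B; rewrite EFinM -muleA.
have hHK : HK (mscale (sqr_nng 0) m) (mscale (sqr_nng 1) m) =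
    (Num.sqrt (c * v))%:E.
  rewrite (HK_scale m (0%:nng) (1%:nng)) /= sub0r normrN1 mul1r.
  by rewrite mT.
have half : 0 <= (2^-1 : R) <= 1 by apply/andP; split; lra.
move=> /(_ _ (geodesic_scale m) _ half).
rewrite !EE hHK -EFin_expe -!EFinM -!EFinD lee_fin.
(* The squared distance from the null measure to [m] is the mass [c * v]. *)
rewrite sqr_sqrtr; last by rewrite mulr_ge0 ?ltW.
have four : 0 < 4 :> R by [].
have lnc : ln c = Lambda / 2 - ln 4.
  by rewrite /c lnM ?posrE ?expR_gt0 ?invr_gt0// lnV ?posrE// expRK.
have -> : 2^-1 ^+ 2 * c = c / 4 by field.
rewrite expr0n mul0r expr1n mul1r /F_B mul0r.
rewrite lnM ?posrE ?invr_gt0// lnV ?posrE// lnc.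
apply/negP; rewrite -ltNge -subr_gt0.
rewrite [X in 0 < X](_ : _ = c * v / 4); last by field.
by rewrite divr_gt0// mulr_gt0.
Qed.
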